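(* Let $G$ be a simple connected graph with $n$ nodes and $m\ge1$ edges, let $q\ge1$ and $k\ge0$ be integers, and let $K_{q,k}$ denote Kemeny's constant of the iterated $q$-triangulation graph $R_{q,k}(G)$ (so $K_{q,0}=K(G)$). Then $$K_{q,k}=\Big(\frac{4q+2}{q+2}\Big)^kK_{q,0}+\frac{m(2q+3)}{2(2q+1)}\Big[(2q+1)^k-\Big(\frac{4q+2}{q+2}\Big)^k\Big]+\bigg(\frac{q-1}{3(2q+1)}+\frac{m-2n}{6}\bigg)\Big[\Big(\frac{4q+2}{q+2}\Big)^k-1\Big].$$
   Context: For a positive integer $q$, the $q$-triangulation graph $R_q(G)$ is obtained from $G$ by keeping all nodes and edges of $G$ and adding, for each edge $uv$ of $G$, $q$ disjoint paths of length $2$: $ux_1v,\dots,ux_qv$, where $x_1,\dots,x_q$ are new nodes. The iterated $q$-triangulation graphs are $R_{q,0}(G)=G$ and $R_{q,k}(G)=R_q(R_{q,k-1}(G))$ for $k\ge1$. For a simple connected graph with $m$ edges and degrees $d_i$, consider the simple unbiased random walk (from $i$ to each neighbor with probability $1/d_i$), with stationary distribution $\pi_i=d_i/2m$; $T_{ij}$ is the expected number of steps to first reach $j$ from $i$ ($T_{ii}=0$). Kemeny's constant is $K(G)=\sum_j\pi_jT_{ij}$, which is independent of $i$; it equals $\sum_{i=2}^n\frac1{1-\lambda_i}$, where $1=\lambda_1>\lambda_2\ge\cdots\ge\lambda_n$ are the eigenvalues of the normalized adjacency matrix $D^{-1/2}AD^{-1/2}$ ($A$ adjacency matrix, $D$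 diagonal degree matrix). *)

(* Defs.v *)
From HB Require Import structures.
From mathcomp Require Import all_boot all_order all_algebra.
From mathcomp Require Import reals constructive_ereal ereal sequences.

Set Implicit Arguments.
Unset Strict Implicit.
Unset Printing Implicit Defensive.

Import Order.TTheory GRing.Theory Num.Theory.

Local Open Scope ring_scope.

Record sgraph := SGraph {
  node :> finType;
  adj : rel node;
  adj_sym : symmetric adj;
  adj_irr : irreflexive adj }.

(* An edge is the two-element set of its end nodes. *)
Definition edges (G : sgraph) : {set {set G}} :=
  [set [set p.1; p.2] | p : G * G & adj p.1 p.2].

Definition degree (G : sgraph) (u : G) : nat := #|[set v | adj u v]|.

Definition graph_connected (G : sgraph) : Prop :=
  forall u v : G, connect (@adj G) u v.

Section QTriangulation.
Variables (q : nat) (G : sgraph).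

(* inr (e, a) is the a-th of the q new nodes placed on the edge e. *)
Definition qtri_node : finType := (G + {e | e \in edges G} * 'I_q)%type.

Definition qtri_adj : rel qtri_node := fun x y =>
  match x, y with
  | inl u, inl v => adj u v
  | inl u, inr (e, _) => u \in val e
  | inr (e, _), inl v => v \in val e
  | inr _, inr _ => false
  end.

Fact qtri_adj_sym : symmetric qtri_adj.
Proof. by move=> [u|[e a]] [v|[f b]] //=; exact: adj_sym. Qed.

Fact qtri_adj_irr : irreflexive qtri_adj.
Proof. by move=> [u|[e a]] //=; exact: adj_irr. Qed.

Definition qtri : sgraph := SGraph qtri_adj_sym qtri_adj_irr.

End QTriangulation.

Definition iter_qtri (q k : nat) (G : sgraph) : sgraph := iter k (qtri q) G.

Section RandomWalk.
Variables (R : realType) (G : sgraph).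

Definition trans_pr (u v : G) : R := if adj u v then (degree u)%:R^-1 else 0.

Definition stationary (u : G) : R := (degree u)%:R / (2 * #|edges G|%:R).

(* Probability that the walk started at i visits the nodes of w, in order, in
   its first [size w] steps. *)
Definition walk_pr (i : G) (w : seq G) : R :=
  \prod_(s < size w) trans_pr (nth i (i :: w) s) (nth i w s).

(* Probability that the walk started at i is at j for the first time after
   exactly t steps; time 0 counts, so for i = j the first visit is at t = 0.
   [index j (i :: w)] is the first position of j in the trajectory. *)
Definition first_hit_pr (i j : G) (t : nat) : R :=
  \sum_(w : t.-tuple G | index j (i :: w) == t) walk_pr i w.

(* Mean of the first hitting time. A probability mass at infinity is not
   counted; it is zero when G is connected. *)
Definition hitting_time (i j : G) : \bar R :=
  (\sum_(0 <= t <oo) (t%:R * first_hit_pr i j t)%:E)%E.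

(* The start node i is kept as an argument: the value does not depend on it
   when G is connected. *)
Definition kemeny (i : G) : R :=
  \sum_(j : G) stationary j * fine (hitting_time i j).

End RandomWalk.

Arguments kemeny R {G} i.

(* Main.v *)
From HB Require Import structures.
Require Import Defs.
From mathcomp Require Import all_boot all_order all_algebra.
From mathcomp Require Import ring lra.
From mathcomp Require Import reals constructive_ereal ereal topology normedtype.
From mathcomp Require Import sequences.

Set Implicit Arguments.
Unset Strict Implicit.
Unset Printing Implicit Defensive.

Import Order.TTheory GRing.Theory Num.Theory.
Import numFieldNormedType.Exports.

(** Mean hitting times are the unique solution of a linear system: writing
[Pf] for the function whose value at [u] is the average of [f] over the
neighbours of [u], the function [h = T_(., j)] is determined by [h j = 0] and
[h u = 1 + (Ph) u] for [u != j] ([mean_hit_eqns], [hitting_eqns_unique]). So a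
hitting time on the triangulated graph [H = R_q(G)] can be found by guessing a
formula and checking these equations.

Put [c = (4q+2)/(q+2)] and let [m], [m' = (2q+1) m] be the numbers of edges of
[G] and [H].
- Between old nodes every hitting time is multiplied by [c]
  ([mean_hit_qtri_old]): a new node on [uv] leads to [u] or [v] with
  probability 1/2, and eliminating the new nodes from the equations of [H]
  leaves those of [G], with [c] instead of 1 as the cost of a step.
- If [y] is a new node on the edge [e], then
  [T'_xy = S_x - m' [x = y] + (m' - S_y)], where [S_x] is the mean of [T'_xa]
  over the two ends [a] of [e] ([mean_hit_qtri_new]): applying [I - P'] to
  both sides gives the same point masses at [y] and at the ends of [e].

Summing these against the stationary distribution leaves two sums over the
edges of [G]: the sum of [T_ia] over edges and their ends [a], which is
[2m K(G)], and the sum of [T_ab + T_ba] over edges, which is [2m(n-1)] because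
the mean return time to [a] is [2m/d_a] ([sum_edge_mean_hit_ends]). The result
is the recurrence [kemeny_qtri]
   [K(H) = c K(G) + q m - q/(2q+1) - q(n-1)/(q+2)],
and the closed form follows by induction on [k], using
[m_k = (2q+1)^k m] and [n_k = n + m((2q+1)^k - 1)/2]. *)

Local Open Scope ring_scope.

(** * Averaging over neighbours and the maximum principle *)

Section NeighbourAverage.
Variables (R : realType) (G : sgraph).
Implicit Types (f g : G -> R) (u v j : G).

Definition nbr_avg f u : R := \sum_(v : G) trans_pr R u v * f v.

Lemma trans_pr_ge0 u v : 0 <= trans_pr R u v.
Proof. by rewrite /trans_pr; case: ifP; rewrite ?invr_ge0 ?ler0n. Qed.

Lemma eq_nbr_avg f g : f =1 g -> nbr_avg f =1 nbr_avg g.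
Proof. by move=> fg u; apply: eq_bigr => v _; rewrite fg. Qed.

Lemma nbr_avgD f g u :
  nbr_avg (fun v => f v + g v) u = nbr_avg f u + nbr_avg g u.
Proof. by rewrite -big_split; apply: eq_bigr => v _; rewrite mulrDr. Qed.

Lemma nbr_avgZ c f u : nbr_avg (fun v => c * f v) u = c * nbr_avg f u.
Proof. by rewrite mulr_sumr; apply: eq_bigr => v _; rewrite mulrCA. Qed.

Lemma nbr_avgN f u : nbr_avg (fun v => - f v) u = - nbr_avg f u.
Proof. by rewrite -sumrN; apply: eq_bigr => v _; rewrite mulrN. Qed.

Lemma nbr_avgB f g u :
  nbr_avg (fun v => f v - g v) u = nbr_avg f u - nbr_avg g u.
Proof. by rewrite nbr_avgD nbr_avgN. Qed.

Lemma nbr_avg_sum (I : finType) (P : pred I) (F : I -> G -> R) u :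
  nbr_avg (fun v => \sum_(i | P i) F i v) u = \sum_(i | P i) nbr_avg (F i) u.
Proof.
by rewrite exchange_big; apply: eq_bigr => v _; rewrite mulr_sumr.
Qed.

Lemma le_nbr_avg f g u : (forall v, f v <= g v) -> nbr_avg f u <= nbr_avg g u.
Proof.
by move=> fg; apply: ler_sum => v _; rewrite ler_wpM2l ?trans_pr_ge0.
Qed.

Lemma degree_nbr_avg f u :
  (degree u)%:R * nbr_avg f u = \sum_(v | adj u v) f v.
Proof.
rewrite [RHS]big_mkcond mulr_sumr; apply: eq_bigr => v _; rewrite /trans_pr.
case: ifP => [uv|_]; last by rewrite mul0r mulr0.
rewrite mulVKf // pnatr_eq0 -lt0n; apply/card_gt0P.
by exists v; rewrite inE.
Qed.

Lemma eq_nbr_avg_sum f u c :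
  (0 < degree u)%N -> (degree u)%:R * c = \sum_(v | adj u v) f v ->
  nbr_avg f u = c.
Proof.
move=> du; rewrite -degree_nbr_avg => /mulfI -> //.
by rewrite pnatr_eq0 -lt0n.
Qed.

Hypotheses (hG : graph_connected G) (hm : (1 <= #|edges G|)%N).

Lemma connected_degree_gt0 u : (0 < degree u)%N.
Proof.
have /card_gt0P[e /imsetP[[a b] /= ab _]] := hm.
have [w uw] : exists w, w != u.
  have [->|] := eqVneq u a; last by exists a; rewrite eq_sym.
  by exists b; apply: contraTneq ab => ->; rewrite inE adj_irr.
have /connectP[[|v p] /=] := hG u w.
  by move=> _ wu; rewrite wu eqxx in uw.
by case/andP=> uv _ _; apply/card_gt0P; exists v; rewrite inE.
Qed.

Lemma degree_neq0 u : (degree u)%:R != 0 :> R.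
Proof. by rewrite pnatr_eq0 -lt0n connected_degree_gt0. Qed.

Lemma nbr_avg_cst c u : nbr_avg (fun=> c) u = c.
Proof.
apply: eq_nbr_avg_sum; first exact: connected_degree_gt0.
rewrite sumr_const mulr_natl; congr (_ *+ _).
by rewrite /degree cardsE.
Qed.

(** Maximum principle: at a maximum of [f] outside [j] all neighbours are
maxima as well, so following a path to [j] shows that [j] is a maximum. *)
Lemma subharmonic_le f j :
  (forall u, u != j -> f u <= nbr_avg f u) -> forall u, f u <= f j.
Proof.
move=> sub u.
(* [x] runs along a path from the maximum [M] to [j]; [Mx] says that [f x] is
   maximal. *)
pose M := [arg max_(i > j) f i]%O.
have fM v : f v <= f M by rewrite /M; case: arg_maxP => // i _; apply.
suff: f M <= f j by apply: le_trans.
have /connectP[p] := hG M j.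
have : f M <= f M by [].
move: {2 3 4}M => x; elim: p x => [x Mx _ ->//|y p IH x Mx] /= /andP[xy pth] jE.
have [<-//|xj] := eqVneq x j.
apply: (le_trans _ (IH y _ pth jE)) => //.
have nonneg v : adj x v -> 0 <= f M - f v by rewrite subr_ge0.
(* The nonnegative gaps [f M - f v] have a nonpositive sum, so all vanish. *)
have : \sum_(v | adj x v) (f M - f v) == 0.
  rewrite eq_le sumr_ge0 // andbT -degree_nbr_avg pmulr_rle0; last first.
    by rewrite ltr0n connected_degree_gt0.
  by rewrite nbr_avgB nbr_avg_cst subr_le0 (le_trans Mx) ?sub.
rewrite psumr_eq0 // => /allP /(_ y); rewrite mem_index_enum xy => /(_ isT).
by rewrite subr_eq0 => /eqP ->.
Qed.

Lemma harmonic_off_eq0 f j :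
  f j = 0 -> (forall u, u != j -> f u = nbr_avg f u) -> forall u, f u = 0.
Proof.
move=> fj har u; apply/eqP; rewrite eq_le; apply/andP; split.
  by rewrite -fj; apply: subharmonic_le => v /har ->.
rewrite -fj -lerN2; apply: (@subharmonic_le (fun v => - f v)) => v /har fv.
by rewrite nbr_avgN -fv.
Qed.

(** First-step analysis: the system satisfied by the mean time to reach [j]. *)
Definition hitting_eqns j f :=
  f j = 0 /\ forall u, u != j -> f u = 1 + nbr_avg f u.

Lemma hitting_eqns_unique j f g :
  hitting_eqns j f -> hitting_eqns j g -> f =1 g.
Proof.
move=> [f0 fE] [g0 gE] u; apply/subr0_eq.
apply: (@harmonic_off_eq0 (fun v => f v - g v) j) => [|v vj].
  by rewrite f0 g0 subrr.
by rewrite nbr_avgB fE // gE // opprD addrACA subrr add0r.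
Qed.

(** The maximum principle makes the homogeneous system injective, and an
injective endomorphism of a finite-dimensional space is onto. The solution
obtained in this way serves as the a priori bound that makes the series of
mean hitting times converge. *)
Lemma hitting_eqns_solvable j : exists f, hitting_eqns j f.
Proof.
pose phi (f : {ffun G -> R^o}) : {ffun G -> R^o} :=
  [ffun u => if u == j then f u else f u - nbr_avg f u].
have phi_lin : linear phi.
  move=> c f g; apply/ffunP => u; rewrite !ffunE.
  have -> : nbr_avg (c *: f + g) u = c * nbr_avg f u + nbr_avg g u.
    by rewrite -nbr_avgZ -nbr_avgD; apply: eq_nbr_avg => v; rewrite !ffunE.
  case: ifP => // _; rewrite /GRing.scale /=; ring.
pose Phi := HB.pack_for {linear {ffun G -> R^o} -> {ffun G -> R^o}} phi
  (GRing.isLinear.Build _ _ _ _ _ phi_lin).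
pose L := linfun Phi.
have LE (h : {ffun G -> R^o}) : L h = phi h by rewrite lfunE.
have kerL : lker L == 0%VS.
  rewrite -subv0; apply/subvP => f; rewrite memv_ker memv0 LE => /eqP f0.
  apply/eqP/ffunP => u; rewrite [RHS]ffunE.
  apply: (@harmonic_off_eq0 f j) => [|v vj].
    by move/ffunP/(_ j): f0; rewrite !ffunE eqxx.
  by move/ffunP/(_ v): f0; rewrite !ffunE (negPf vj) => /subr0_eq.
pose b : {ffun G -> R^o} := [ffun u => (u != j)%:R].
exists (L^-1%VF b).
have /ffunP Lb : phi (L^-1%VF b) = b by rewrite -LE lker0_lfunVK.
split; first by have := Lb j; rewrite !ffunE eqxx.
move=> u uj; have := Lb u; rewrite !ffunE (negPf uj) => /eqP.
by rewrite subr_eq => /eqP.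
Qed.

End NeighbourAverage.

(** * Hitting times solve the first-step equations *)

Section HittingTime.
Local Open Scope classical_set_scope.
Local Open Scope ring_scope.
Variables (R : realType) (G : sgraph).
Implicit Types (i j u v : G) (t N : nat).

Lemma walk_pr_cons i v (w : seq G) :
  walk_pr R i (v :: w) = trans_pr R i v * walk_pr R v w.
Proof.
rewrite /walk_pr /= big_ord_recl /=; congr (_ * _).
apply: eq_bigr => s _.
by rewrite !(set_nth_default v i) //= add0n // ltnS ltnW.
Qed.

Lemma first_hit_pr0 i j : first_hit_pr R i j 0 = (i == j)%:R.
Proof.
rewrite /first_hit_pr; have [<-|ij] := eqVneq i j.
  rewrite (big_pred1 [tuple]) => [|w]; first by rewrite /walk_pr big_ord0.
  by rewrite tuple0 /= !eqxx.
by rewrite big_pred0 // => w; rewrite tuple0 /= (negPf ij).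
Qed.

Lemma first_hit_pr_start j t : first_hit_pr R j j t.+1 = 0.
Proof. by rewrite /first_hit_pr big_pred0 // => w; rewrite /= eqxx. Qed.

Lemma first_hit_prS i j t : i != j ->
  first_hit_pr R i j t.+1 = nbr_avg (fun v => first_hit_pr R v j t) i.
Proof.
move=> ij; rewrite /nbr_avg /first_hit_pr.
under [RHS]eq_bigr do rewrite mulr_sumr.
rewrite pair_big_dep /=.
rewrite (reindex (fun p : G * t.-tuple G => [tuple of p.1 :: p.2])) /=;
    last first.
  exists (fun w => (thead w, [tuple of behead w])) => [[v w] _|w _] /=.
    by congr pair; apply: val_inj.
  by rewrite [w in RHS]tuple_eta.
by apply: eq_big => [[v w]|[v w] _] /=; rewrite ?(negPf ij) ?walk_pr_cons.
Qed.

Lemma first_hit_pr_ge0 i j t : 0 <= first_hit_pr R i j t.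
Proof.
by apply: sumr_ge0 => w _; apply: prodr_ge0 => s _; exact: trans_pr_ge0.
Qed.

Definition hit_before j N i : R := \sum_(0 <= t < N) first_hit_pr R i j t.

Definition truncated_mean j N i : R :=
  \sum_(0 <= t < N) t%:R * first_hit_pr R i j t.

Lemma hit_before_start j N : hit_before j N.+1 j = 1.
Proof.
rewrite /hit_before big_nat_recl // first_hit_pr0 eqxx big1 ?addr0 // => t _.
exact: first_hit_pr_start.
Qed.

Lemma truncated_mean_start j N : truncated_mean j N j = 0.
Proof.
rewrite /truncated_mean big1 // => -[|t] _; first by rewrite mul0r.
by rewrite first_hit_pr_start mulr0.
Qed.

Lemma nbr_avg_nat_sum (F : nat -> G -> R) N u :
  nbr_avg (fun v => \sum_(0 <= t < N) F t v) u =
  \sum_(0 <= t < N) nbr_avg (F t) u.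
Proof.
rewrite big_mkord -nbr_avg_sum; apply: eq_nbr_avg => v; exact: big_mkord.
Qed.

Lemma hit_beforeS j N i : i != j ->
  hit_before j N.+1 i = nbr_avg (hit_before j N) i.
Proof.
move=> ij; rewrite /hit_before big_nat_recl // first_hit_pr0 (negPf ij) add0r.
by rewrite nbr_avg_nat_sum; apply: eq_bigr => t _; exact: first_hit_prS.
Qed.

Lemma truncated_meanS j N i : i != j ->
  truncated_mean j N.+1 i =
  nbr_avg (hit_before j N) i + nbr_avg (truncated_mean j N) i.
Proof.
move=> ij; rewrite /truncated_mean big_nat_recl // mul0r add0r.
rewrite !nbr_avg_nat_sum -big_split; apply: eq_bigr => t _ /=.
by rewrite first_hit_prS // nbr_avgZ -natr1 mulrDl mul1r addrC.
Qed.

Lemma truncated_mean_ge0 j N i : 0 <= truncated_mean j N i.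
Proof. by apply: sumr_ge0 => t _; rewrite mulr_ge0 ?first_hit_pr_ge0. Qed.

Hypotheses (hG : graph_connected G) (hm : (1 <= #|edges G|)%N).

Lemma hit_before_le1 j N i : hit_before j N i <= 1.
Proof.
elim: N i => [|N IH] i; first by rewrite /hit_before big_geq.
have [->|ij] := eqVneq i j; first by rewrite hit_before_start.
by rewrite hit_beforeS // -[leRHS](nbr_avg_cst hG hm 1 i) le_nbr_avg.
Qed.

Lemma hitting_eqns_ge0 j (f : G -> R) i : hitting_eqns j f -> 0 <= f i.
Proof.
move=> [f0 fE]; rewrite -f0 -lerN2.
apply: (@subharmonic_le _ _ hG hm (fun v => - f v)) => v vj.
by rewrite nbr_avgN {1}fE // lerN2 lerDr.
Qed.

(** The left-hand side is the mean of the minimum of [N] and the hitting time.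
It obeys the first-step recurrence of [f] but starts from 0, hence stays below
the nonnegative [f]. This one bound gives both the finiteness of the mean
hitting time and, on dividing by [N], that the walk hits [j] almost surely. *)
Lemma mean_min_hitting_le j (f : G -> R) N i : hitting_eqns j f ->
  truncated_mean j N i + N%:R * (1 - hit_before j N i) <= f i.
Proof.
move=> fj; have [f0 fE] := fj; elim: N i => [|N IH] i.
  by rewrite /truncated_mean big_geq // mul0r addr0 (hitting_eqns_ge0 i fj).
have [->|ij] := eqVneq i j.
  by rewrite truncated_mean_start hit_before_start subrr mulr0 addr0 f0.
rewrite truncated_meanS // hit_beforeS // fE //.
have := le_nbr_avg i IH.
rewrite nbr_avgD nbr_avgZ nbr_avgB (nbr_avg_cst hG hm) -natr1; lra.
Qed.

Lemma truncated_mean_le j (f : G -> R) N i :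
  hitting_eqns j f -> truncated_mean j N i <= f i.
Proof.
move=> fj; apply: le_trans (mean_min_hitting_le N i fj).
by rewrite lerDl mulr_ge0 ?subr_ge0 ?hit_before_le1.
Qed.

(** By the previous bound the probability of missing [j] during the first
[N + 1] steps is at most [f i / (N + 1)]. *)
Lemma cvg_hit_before j i : hit_before j N i @[N --> \oo] --> (1 : R).
Proof.
have [f fj] := hitting_eqns_solvable R hG hm j.
rewrite -cvg_shiftS /=.
apply: (@squeeze_cvgr _ _ _ _ (fun N => 1 - f i * harmonic N) (fun=> 1)).
- apply: nearW => N; rewrite hit_before_le1 andbT lerBlDr -lerBlDl /harmonic.
  rewrite ler_pdivlMr ?ltr0n // mulrC.
  apply: le_trans (mean_min_hitting_le N.+1 i fj).
  by rewrite lerDr truncated_mean_ge0.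
- rewrite -[X in _ --> X]subr0 -[X in _ - X](mulr0 (f i)).
  apply: cvgB; first exact: cvg_cst.
  by apply: cvgMl_tmp; exact: cvg_harmonic.
- exact: cvg_cst.
Qed.

Lemma is_cvg_truncated_mean j i : cvgn (fun N => truncated_mean j N i).
Proof.
have [f fj] := hitting_eqns_solvable R hG hm j.
apply: nondecreasing_is_cvgn.
  apply/nondecreasing_seqP => N; rewrite /truncated_mean big_nat_recr //=.
  by rewrite lerDl mulr_ge0 ?first_hit_pr_ge0.
by exists (f i) => _ [N _ <-]; exact: truncated_mean_le.
Qed.

Lemma hitting_timeE j i :
  hitting_time R i j = (limn (fun N => truncated_mean j N i))%:E.
Proof.
rewrite -EFin_lim; last exact: is_cvg_truncated_mean.
by congr (limn _); apply/boolp.funext => N /=; rewrite sumEFin.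
Qed.

Definition mean_hit j i : R := fine (hitting_time R i j).

Lemma cvg_truncated_mean j i :
  truncated_mean j N i @[N --> \oo] --> mean_hit j i.
Proof. rewrite /mean_hit hitting_timeE; exact: is_cvg_truncated_mean. Qed.

Lemma cvg_nbr_avg (F : nat -> G -> R) (f : G -> R) u :
  (forall v, F N v @[N --> \oo] --> f v) ->
  nbr_avg (F N) u @[N --> \oo] --> nbr_avg f u.
Proof.
move=> Ff; apply: cvg_big => [|v _]; first exact: add_continuous.
by apply: cvgMl_tmp.
Qed.

(** Limit of [truncated_meanS]; the summand 1 is the limit of [hit_before],
so it is here that almost sure hitting matters. *)
Lemma mean_hit_eqns j : hitting_eqns j (mean_hit j).
Proof.
split=> [|u uj].
  rewrite -(cvg_lim _ (@cvg_truncated_mean j j)) //; apply: cvg_lim => //.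
  under eq_cvg do rewrite truncated_mean_start.
  exact: cvg_cst.
have := @cvg_truncated_mean j u; rewrite -cvg_shiftS /= => cu.
rewrite -(cvg_lim _ cu) //; apply: cvg_lim => //.
under eq_cvg do rewrite truncated_meanS //.
apply: cvgD; last exact/cvg_nbr_avg/cvg_truncated_mean.
rewrite -[X in _ --> X](nbr_avg_cst hG hm 1 u).
apply: cvg_nbr_avg => v; exact: cvg_hit_before.
Qed.

End HittingTime.

(** * Sums over edges *)

Section EdgeSums.
Variables (V : nmodType) (G : sgraph).
Implicit Types (u v : G) (e : {set G}).

Lemma adj_neq u v : adj u v -> u != v.
Proof. by apply: contraTneq => ->; rewrite adj_irr. Qed.

Lemma edge_set2 u v : adj u v -> [set u; v] \in edges G.
Proof. by move=> uv; apply/imsetP; exists (u, v); rewrite ?inE. Qed.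

Lemma card_edge e : e \in edges G -> #|e| = 2.
Proof.
by move=> /imsetP[[u v]]; rewrite inE => /adj_neq uv ->; rewrite cards2 uv.
Qed.

Lemma sum_set2 (f : G -> V) u v :
  adj u v -> \sum_(w in [set u; v]) f w = f u + f v.
Proof. by move=> /adj_neq uv; rewrite big_setU1 ?inE // big_set1. Qed.

(** Edges are sets of nodes, so this turns sums over the edges through [u]
into sums over its neighbours. *)
Lemma incident_edges u :
  [set [set u; v] | v in [set v | adj u v]] = [set e in edges G | u \in e].
Proof.
apply/setP => e; rewrite inE; apply/imsetP/andP => [[v]|[]].
  by rewrite inE => uv ->; rewrite edge_set2 // !inE eqxx.
move=> /imsetP[[a b]]; rewrite inE => /= ab ->; rewrite !inE => /orP[]/eqP->.
  by exists b; rewrite ?inE.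
by exists a; rewrite ?inE 1?adj_sym // setUC.
Qed.

Lemma sum_incident_edges (F : {set G} -> V) u :
  \sum_(e in edges G | u \in e) F e = \sum_(v | adj u v) F [set u; v].
Proof.
transitivity (\sum_(e in [set e in edges G | u \in e]) F e).
  by apply: eq_bigl => e; rewrite inE.
rewrite -incident_edges big_imset /=; first by apply: eq_bigl => v; rewrite inE.
move=> v w; rewrite !inE => uv uw /setP/(_ v).
rewrite !inE eqxx orbT => /esym/orP[]/eqP // vu.
by rewrite vu adj_irr in uv.
Qed.

Lemma sum_edge_ends (f : G -> V) :
  \sum_(e in edges G) \sum_(a in e) f a = \sum_a f a *+ degree a.
Proof.
rewrite (exchange_big_dep xpredT) //=; apply: eq_bigr => a _.
rewrite (sum_incident_edges (fun=> f a)) sumr_const; congr (_ *+ _).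
by rewrite /degree cardsE.
Qed.

End EdgeSums.

Lemma sum_degree (G : sgraph) : (\sum_(u : G) degree u = 2 * #|edges G|)%N.
Proof.
have := sum_edge_ends (fun _ : G => 1%N).
under [X in _ = X -> _]eq_bigr do rewrite -mulr_natr natn mul1r.
move=> <-; rewrite mulnC -sum_nat_const; apply: eq_bigr => e he.
by rewrite sum1_card; exact: card_edge.
Qed.

(** * Return times and Kemeny's constant *)

Section Kemeny.
Variables (R : realType) (G : sgraph).
Hypotheses (hG : graph_connected G) (hm : (1 <= #|edges G|)%N).
Implicit Types (u v j : G).
Let m : R := #|edges G|%:R.

Lemma sum_degreeR : \sum_(u : G) (degree u)%:R = 2 * m.
Proof. by rewrite -natr_sum sum_degree natrM. Qed.

Lemma edges_neq0 : m != 0.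
Proof. by rewrite pnatr_eq0 -lt0n. Qed.

(** Stationarity of the degree weights: the adjacency relation is
symmetric. *)
Lemma sum_degree_nbr_avg (f : G -> R) :
  \sum_u (degree u)%:R * nbr_avg f u = \sum_u (degree u)%:R * f u.
Proof.
under eq_bigr do rewrite degree_nbr_avg.
rewrite (exchange_big_dep xpredT) //=; apply: eq_bigr => u _.
rewrite sumr_const mulr_natl; congr (_ *+ _).
by apply: eq_card => v; rewrite !inE adj_sym.
Qed.

(** Sum the first-step equations against the degrees: by stationarity the
hitting times cancel, and only the defect at [j] remains to balance the total
degree. *)
Lemma mean_return_time j :
  (degree j)%:R * (1 + nbr_avg (mean_hit R j) j) = 2 * m.
Proof.
have [h0 hE] := mean_hit_eqns R hG hm j.
rewrite -sum_degreeR (bigD1 j) //=.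
have := sum_degree_nbr_avg (mean_hit R j).
rewrite (bigD1 j) //= [X in _ = X](bigD1 j) //= h0 mulr0 add0r.
under [X in _ = X -> _]eq_bigr => u uj do rewrite hE // mulrDr mulr1.
rewrite big_split /= => /addIr E.
by rewrite mulrDr mulr1 E.
Qed.

(** First-step equations and return time in one formula, valid at all nodes:
the Laplacian of a hitting time is constant up to a point mass. *)
Lemma nbr_avg_mean_hit j u : nbr_avg (mean_hit R j) u =
  mean_hit R j u - 1 + (u == j)%:R * (2 * m / (degree u)%:R).
Proof.
have [h0 hE] := mean_hit_eqns R hG hm j.
have [->|uj] := eqVneq u j; last by rewrite hE // mul0r addr0 addrC addKr.
rewrite h0 -(mean_return_time j) /=; have d0 := degree_neq0 R hG hm j.
by field.
Qed.

Lemma kemenyE u : kemeny R u = \sum_j stationary R j * mean_hit R j u.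
Proof. by []. Qed.

(** In the stationary average of the hitting times the point masses cancel the
constant 1, so Kemeny's constant is a harmonic function of its starting node;
the maximum principle, applied with any target, makes it constant. *)
Lemma kemeny_start_indep u v : kemeny R u = kemeny R v.
Proof.
suff har (w : G) : kemeny R w = nbr_avg (kemeny R) w.
  apply/eqP; rewrite eq_le.
  by rewrite !(@subharmonic_le _ _ hG hm (kemeny R)) // => w _; rewrite -har.
rewrite (nbr_avg_sum xpredT (fun j v => stationary R j * mean_hit R j v)).
under [RHS]eq_bigr do rewrite nbr_avgZ nbr_avg_mean_hit mulrDr mulrBr mulr1.
rewrite big_split sumrB /= -kemenyE.
rewrite -mulr_suml sum_degreeR divff ?mulf_neq0 ?pnatr_eq0 -?lt0n //.
rewrite (bigD1 w) //= big1 => [|j jw]; last first.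
  by rewrite eq_sym (negPf jw) mul0r mulr0.
rewrite eqxx mul1r addr0 /stationary -/m.
have := degree_neq0 R hG hm w; have := edges_neq0 => m0 d0.
by field; rewrite m0 d0.
Qed.

Lemma sum_edge_mean_hit u :
  \sum_(e in edges G) \sum_(a in e) mean_hit R a u = 2 * m * kemeny R u.
Proof.
rewrite sum_edge_ends kemenyE mulr_sumr; apply: eq_bigr => j _.
rewrite -mulr_natl /stationary -/m; have := edges_neq0 => m0.
by field.
Qed.

(** Foster's formula: grouping the sum by the target [a] gives
[d_a] times the mean hitting time of [a] from a random neighbour, which is
[2m - d_a] by the return time. *)
Lemma sum_edge_mean_hit_ends :
  \sum_(e in edges G) \sum_(a in e) \sum_(b in e) mean_hit R a b =
  2 * m * (#|G|%:R - 1).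
Proof.
rewrite (exchange_big_dep xpredT) //=.
transitivity (\sum_(a : G) (2 * m - (degree a)%:R)).
  apply: eq_bigr => a _.
  rewrite (sum_incident_edges (fun e => \sum_(b in e) _)).
  rewrite -(mean_return_time a) mulrDr mulr1 addrC addKr degree_nbr_avg.
  apply: eq_bigr => v av; rewrite sum_set2 //.
  by rewrite (mean_hit_eqns R hG hm a).1 add0r.
rewrite sumrB sum_degreeR sumr_const -mulr_natr; ring.
Qed.

End Kemeny.

(** * Counting in the triangulated graph *)

Section QTriangulationSums.
Variables (V : nmodType) (q : nat) (G : sgraph).
Implicit Types (u v j : G).

(** All conditions and summands of interest depend on a new node only through
the edge that carries it; the [q] copies then contribute a factor [q]. *)
Lemma qtri_big (P : pred (qtri q G)) (p : pred {set G}) (f : qtri q G -> V) F :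
    (forall e a, P (inr (e, a)) = p (val e)) ->
    (forall e a, f (inr (e, a)) = F (val e)) ->
  \sum_(x : qtri q G | P x) f x =
  \sum_(u : G | P (inl u)) f (inl u) + (\sum_(e in edges G | p e) F e) *+ q.
Proof.
move=> Pp fF; rewrite big_sumType /=; congr (_ + _).
rewrite big_sub_cond -sumrMnl.
transitivity
  (\sum_(e : {e | e \in edges G} | p (val e)) \sum_(a : 'I_q) F (val e)).
  rewrite pair_big_dep /=; apply: eq_big => [[e a]|[e a] _] /=.
    by rewrite Pp andbT.
  exact: fF.
by apply: eq_bigr => e _; rewrite sumr_const card_ord.
Qed.

Lemma qtri_sum_nbrs_old (f : qtri q G -> V) F u :
  (forall e a, f (inr (e, a)) = F (val e)) ->
  \sum_(x : qtri q G | adj (inl u : qtri q G) x) f x =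
  \sum_(v | adj u v) (f (inl v) + F [set u; v] *+ q).
Proof.
move=> fF; rewrite (qtri_big (p := fun e => u \in e) _ fF) //=.
by rewrite sum_incident_edges big_split -sumrMnl.
Qed.

Lemma qtri_sum_nbrs_new (f : qtri q G -> V) e a :
  \sum_(x : qtri q G | adj (inr (e, a) : qtri q G) x) f x =
  \sum_(u in val e) f (inl u).
Proof.
by rewrite big_sumType /= [X in _ + X]big_pred0 ?Monoid.mulm1 // => -[].
Qed.

End QTriangulationSums.

Section QTriangulationGraph.
Variables (q : nat) (G : sgraph).
Local Notation H := (qtri q G).
Implicit Types (u v j : G).

Lemma degree_sum1 (K : sgraph) (x : K) : degree x = (\sum_(y | adj x y) 1)%N.
Proof. by rewrite sum1_card /degree cardsE. Qed.

Lemma qtri_degree_old u : degree (inl u : H) = (q.+1 * degree u)%N.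
Proof.
rewrite !degree_sum1 (qtri_sum_nbrs_old (F := fun=> 1%N)) // big_distrr /=.
by apply: eq_bigr => v _; rewrite -mulr_natr natn mul1r muln1.
Qed.

Lemma qtri_degree_new e a : degree (inr (e, a) : H) = 2.
Proof.
by rewrite degree_sum1 qtri_sum_nbrs_new sum1_card (card_edge (valP e)).
Qed.

Lemma qtri_card_nodes : #|H| = (#|G| + #|edges G| * q)%N.
Proof. by rewrite card_sum card_prod card_sig card_ord. Qed.

(** Obtained from the degrees through the handshake formula, which avoids
classifying the edges. *)
Lemma qtri_card_edges : #|edges H| = ((2 * q).+1 * #|edges G|)%N.
Proof.
apply/eqP; rewrite -(eqn_pmul2l (ltn0Sn 1)) -sum_degree; apply/eqP.
rewrite (qtri_big (p := xpredT) (F := fun=> 2%N)) //=; last first.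
  by move=> e a; rewrite qtri_degree_new.
transitivity (q.+1 * (2 * #|edges G|) + q * (#|edges G| * 2))%N; last by ring.
congr (_ + _)%N; last first.
  rewrite -mulr_natl natn -sum_nat_const; congr (_ * _)%N.
  by apply: eq_bigl => e; rewrite andbT.
rewrite -sum_degree big_distrr; apply: eq_bigr => u _.
exact: qtri_degree_old.
Qed.

Lemma qtri_connected : graph_connected G -> graph_connected H.
Proof.
move=> hG.
have symH : connect_sym (@adj H) by apply: sym_connect_sym; exact: adj_sym.
have old u v : connect (@adj H) (inl u) (inl v).
  have /connectP[p pth ->] := hG u v.
  elim: p u pth => [|w p IH] u /=; first by rewrite connect0.
  move=> /andP[uw /IH]; apply: connect_trans.
  exact: (@connect1 _ (@adj H) (inl u) (inl w)).
have to_old x : exists u, connect (@adj H) x (inl u).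
  case: x => [u|[e a]]; first by exists u; rewrite connect0.
  have /card_gt0P[u ue] : (0 < #|val e|)%N by rewrite (card_edge (valP e)).
  by exists u; apply: (@connect1 _ (@adj H) (inr (e, a)) (inl u)).
move=> x y; have [u xu] := to_old x; have [v yv] := to_old y.
by rewrite (connect_trans xu) // (connect_trans (old u v)) // symH.
Qed.

End QTriangulationGraph.

(** * One triangulation step *)

Section OneStep.
Variables (R : realType) (q : nat) (G : sgraph).
Hypotheses (hG : graph_connected G) (hm : (1 <= #|edges G|)%N).
Local Notation H := (qtri q G).
Implicit Types (u v j : G).
Let n : R := #|G|%:R.
Let m : R := #|edges G|%:R.
Let Q : R := q%:R.
Let c : R := (4 * Q + 2) / (Q + 2).
Let m' : R := #|edges H|%:R.
Let hG' : graph_connected H := @qtri_connected q G hG.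
Let Q_ge0 : 0 <= Q. Proof. exact: ler0n. Qed.

Lemma qtri_edges_gt0 : (1 <= #|edges H|)%N.
Proof. by rewrite qtri_card_edges muln_gt0. Qed.
Let hm' := qtri_edges_gt0.

Lemma qtri_edgesR : m' = (2 * Q + 1) * m.
Proof. by rewrite /m' qtri_card_edges natrM -natr1 natrM. Qed.

(** The value at a new node is forced by the first-step equation there; the
value at an old node is the ansatz that old hitting times scale by [c]. *)
Definition lifted_hit j (x : H) : R :=
  match x with
  | inl u => c * mean_hit R j u
  | inr (e, _) => 1 + c / 2 * \sum_(u in val e) mean_hit R j u
  end.

Lemma lifted_hit_eqns j : hitting_eqns (inl j : H) (lifted_hit j).
Proof.
have [h0 hE] := mean_hit_eqns R hG hm j.
split=> [|[u|[e a]] xj]; first by rewrite /= h0 mulr0.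
- have uj : u != j by apply: contraNneq xj => ->.
  have Q2 : Q + 2 != 0 by rewrite gt_eqF // ltr_wpDl.
  have hu : nbr_avg (mean_hit R j) u = mean_hit R j u - 1.
    by rewrite (hE u uj) addrC addKr.
  apply/eqP; rewrite addrC -subr_eq; apply/eqP/esym/eq_nbr_avg_sum.
    by rewrite qtri_degree_old muln_gt0 connected_degree_gt0.
  rewrite (qtri_sum_nbrs_old
    (F := fun e => 1 + c / 2 * \sum_(v in e) mean_hit R j v)) //.
  rewrite qtri_degree_old natrM -natr1 -/Q.
  (* The copies of the new node on [uv] return to [u] or go on to [v]: the terms
     are collected by the value at [u] and the value at [v]. *)
  transitivity (\sum_(v | adj u v)
     (Q * (1 + c / 2 * mean_hit R j u) + (c + Q * (c / 2)) * mean_hit R j v)).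
    rewrite big_split /= sumr_const -mulr_sumr -degree_nbr_avg hu.
    have -> : #|adj u| = degree u by rewrite /degree cardsE.
    rewrite -mulr_natl /c; by field.
  apply: eq_bigr => v uv; rewrite sum_set2 // -mulr_natl -/Q /=; ring.
- have e2 : #|val e| = 2 := card_edge (valP e).
  rewrite /=; congr (_ + _); apply/esym/eq_nbr_avg_sum.
    by rewrite qtri_degree_new.
  rewrite qtri_degree_new qtri_sum_nbrs_new /= -mulr_sumr; by field.
Qed.

Lemma mean_hit_qtri_old j : mean_hit R (inl j : H) =1 lifted_hit j.
Proof.
apply: (hitting_eqns_unique hG' hm' (mean_hit_eqns R hG' hm' _)).
exact: lifted_hit_eqns.
Qed.

(** The factor 1/2 makes this an average, an edge having two ends. *)
Definition endpoint_hit (e : {set G}) (x : H) : R :=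
  2^-1 * \sum_(a in e) mean_hit R (inl a : H) x.

Lemma endpoint_hit_old (e : {set G}) u :
  endpoint_hit e (inl u) = c / 2 * \sum_(a in e) mean_hit R a u.
Proof.
rewrite /endpoint_hit; under eq_bigr do rewrite mean_hit_qtri_old.
by rewrite /= -mulr_sumr mulrA [2^-1 * c]mulrC.
Qed.

Lemma endpoint_hit_new (e : {e | e \in edges G}) a :
  endpoint_hit (val e) (inr (e, a)) =
  1 + c / 4 * \sum_(u in val e) \sum_(v in val e) mean_hit R u v.
Proof.
have e2 : #|val e| = 2 := card_edge (valP e).
rewrite /endpoint_hit; under eq_bigr do rewrite mean_hit_qtri_old.
rewrite big_split sumr_const /= -mulr_sumr -[sval e]/(val e) e2; by field.
Qed.

Lemma degree_nbr_avg_delta (x y : H) :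
  (degree x)%:R * nbr_avg (fun z => (z == y)%:R : R) x = (adj x y)%:R.
Proof.
rewrite degree_nbr_avg; have [xy|xy] := boolP (adj x y).
  rewrite (bigD1 y) //= eqxx big1 ?addr0 // => z /andP[_ zy].
  by rewrite (negPf zy).
by rewrite big1 // => z xz; case: eqP => // zy; rewrite -zy xz in xy.
Qed.

(** By [nbr_avg_mean_hit], averaging [endpoint_hit] over neighbours adds a
point mass [m'/d] at each end of [e], where [d] is the degree of that end. The
neighbour average of [m'] times the indicator of [y] is exactly this mass,
because the ends of [e] are the neighbours of [y]; subtracting it cancels the
masses. The final constant makes the function vanish at [y]. *)
Lemma mean_hit_qtri_new (e : {e | e \in edges G}) a (x : H)
    (y : H := inr (e, a)) :
  mean_hit R y x =
  endpoint_hit (val e) x - m' * (x == y)%:R + (m' - endpoint_hit (val e) y).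
Proof.
pose f x :=
  endpoint_hit (val e) x - m' * (x == y)%:R + (m' - endpoint_hit (val e) y).
have e2 : #|val e| = 2 := card_edge (valP e).
apply: (hitting_eqns_unique hG' hm' (mean_hit_eqns R hG' hm' _) (g := f)).
split=> [|z zy]; rewrite /f; first by rewrite eqxx mulr1; ring.
rewrite (negPf zy) mulr0 subr0 nbr_avgD nbr_avgB (nbr_avg_cst hG' hm').
rewrite nbr_avgZ [in RHS]addrA; congr (_ + _).
have -> : nbr_avg (endpoint_hit (val e)) z =
    2^-1 * \sum_(b in val e) nbr_avg (mean_hit R (inl b : H)) z.
  by rewrite -nbr_avg_sum -nbr_avgZ.
under [X in _ = 1 + (_ * X - _)]eq_bigr do rewrite (nbr_avg_mean_hit R hG' hm').
rewrite big_split sumrB sumr_const /= -mulr_suml e2 -/m'.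
have d0 := degree_neq0 R hG' hm' z.
(* [z] is adjacent to [y] exactly when it is an end of [e], never twice. *)
have <- : (adj z y)%:R = \sum_(b in val e) (z == inl b)%:R :> R.
  case: (z) zy d0 => [u|[e' a']] _ _ /=; last by rewrite big1.
  have [ue|ue] := boolP (u \in val e).
    rewrite (bigD1 u) //= eqxx big1 ?addr0 // => b /andP[_ bu].
    by rewrite (_ : _ == _ = false) //; apply: contraNF bu => /eqP[->].
  by rewrite big1 // => b be; case: eqP => // -[ub]; rewrite ub be in ue.
rewrite -(degree_nbr_avg_delta z y) /endpoint_hit; by field.
Qed.

(** By independence of the starting node the walk may be started at an old
node, where the two formulas for hitting times apply directly. *)
Lemma kemeny_qtri (i : H) (i0 : G) :
  kemeny R i =
  c * kemeny R i0 + Q * m - Q / (2 * Q + 1) - Q * (n - 1) / (Q + 2).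
Proof.
rewrite (kemeny_start_indep R hG' hm' i (inl i0)) kemenyE.
have m0 : m != 0 := edges_neq0 R hm.
have Q2 : Q + 2 != 0 by rewrite gt_eqF // ltr_wpDl.
have Q1 : 2 * Q + 1 != 0 by rewrite gt_eqF // ltr_wpDl // mulr_ge0.
rewrite (qtri_big (p := xpredT) (F := fun e =>
  m'^-1 * (c / 2 * (\sum_(a in e) mean_hit R a i0) + (m' - 1)
   - c / 4 * \sum_(a in e) \sum_(b in e) mean_hit R a b))) //=; last first.
  move=> e a.
  rewrite mean_hit_qtri_new /stationary qtri_degree_new mulr0 subr0 -/m'.
  rewrite endpoint_hit_old endpoint_hit_new qtri_edgesR -[sval e]/(val e).
  by field; rewrite m0 Q1.
under [X in _ + X *+ _]eq_bigl do rewrite andbT.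
rewrite -mulr_sumr sumrB big_split /= -!mulr_sumr sumr_const.
rewrite -[_ *+ q]mulr_natr -[_ *+ #|edges G|]mulr_natr.
rewrite sum_edge_mean_hit // sum_edge_mean_hit_ends // -/m -/Q -/n.
under eq_bigr => j _ do
  rewrite mean_hit_qtri_old /= /stationary qtri_degree_old natrM -natr1
    -/m' -/Q.
transitivity ((Q + 1) * m * c / m' * kemeny R i0 +
  m'^-1 * (c / 2 * (2 * m * kemeny R i0) + (m' - 1) * m
    - c / 4 * (2 * m * (n - 1))) * Q).
  congr (_ + _); rewrite kemenyE mulr_sumr; apply: eq_bigr => j _.
  rewrite /stationary -/m qtri_edgesR; field; by rewrite m0 Q1.
rewrite qtri_edgesR /c; by field; rewrite m0 Q1 Q2.
Qed.

End OneStep.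

(** * Iteration *)

Lemma iter_qtri_sizes (R : realType) (G : sgraph) (q k : nat)
    (hG : graph_connected G) (hm : (1 <= #|edges G|)%N)
    (n : R := #|G|%:R) (m : R := #|edges G|%:R) (K := iter_qtri q k G) :
  [/\ graph_connected K, (1 <= #|edges K|)%N,
    #|edges K|%:R = (2 * q%:R + 1) ^+ k * m &
    #|K|%:R = n + m * ((2 * q%:R + 1) ^+ k - 1) / 2].
Proof.
rewrite {}/K; elim: k => [|k [hGk hmk mk nk]].
  by rewrite !expr0 mul1r subrr mulr0 mul0r addr0.
split; rewrite ?exprS /=.
- exact: qtri_connected.
- exact: qtri_edges_gt0.
- by rewrite qtri_edgesR mk mulrA.
- by rewrite qtri_card_nodes natrD natrM nk mk; field.
Qed.

Theorem theorem9 (R : realType) (G : sgraph) (q k : nat)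
    (hG : graph_connected G) (hm : (1 <= #|edges G|)%N) (hq : (1 <= q)%N)
    (i0 : G) (i : iter_qtri q k G) :
  let n : R := #|G|%:R in
  let m : R := #|edges G|%:R in
  let Q : R := q%:R in
  let c : R := (4 * Q + 2) / (Q + 2) in
  kemeny R i =
    c ^+ k * kemeny R i0
    + m * (2 * Q + 3) / (2 * (2 * Q + 1)) * ((2 * Q + 1) ^+ k - c ^+ k)
    + ((Q - 1) / (3 * (2 * Q + 1)) + (m - 2 * n) / 6) * (c ^+ k - 1).
Proof.
move=> n m Q c.
have Q_ge0 : 0 <= Q by exact: ler0n.
have Q2 : Q + 2 != 0 by rewrite gt_eqF // ltr_wpDl.
have Q1 : 2 * Q + 1 != 0 by rewrite gt_eqF // ltr_wpDl // mulr_ge0.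
elim: k i => [|k IH] i.
  rewrite (kemeny_start_indep R hG hm i i0) !expr0.
  by rewrite !subrr !mulr0 !addr0 mul1r.
have [hGk hmk mk nk] := iter_qtri_sizes R q k hG hm.
have /card_gt0P[e ek] := hmk.
have /card_gt0P[j _] : (0 < #|e|)%N by rewrite (card_edge ek).
rewrite (kemeny_qtri R hGk hmk i j) (IH j) mk nk -/m -/n -/Q !exprS -/c.
move: (c ^+ k) ((2 * Q + 1) ^+ k) => X Y; rewrite /c.
by field; rewrite Q1 Q2.
Qed.
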